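(* Let $\mathcal{GO}$ be a bivariate general overlap function such that, for all $x,y\in[0,1]$, $\mathcal{GO}(x,y)=0$ implies $xy=0$. Let $N$ be a fuzzy negation and let $I_{\mathcal{GO}}^{N}(x,y)=N(\mathcal{GO}(x,N(y)))$ for $x,y\in[0,1]$. If $N$ is frontier, then $I_{\mathcal{GO}}^{N}$ satisfies (EP1).
   Context: A fuzzy negation is a map $N:[0,1]\to[0,1]$ with $N(0)=1$, $N(1)=0$ and $N(x)\le N(y)$ whenever $y\le x$. It is frontier if, for $x\in[0,1]$, $N(x)\in\{0,1\}$ if and only if $x=0$ or $x=1$. A bivariate general overlap function is a function $\mathcal{GO}:[0,1]^2\to[0,1]$ such that for all $x,y\in[0,1]$: (1) $\mathcal{GO}(x,y)=\mathcal{GO}(y,x)$; (2) if $xy=0$ then $\mathcal{GO}(x,y)=0$; (3) if $xy=1$ then $\mathcal{GO}(x,y)=1$; (4) $\mathcal{GO}$ is increasing (in the non-strict sense) in each variable; (5) $\mathcal{GO}$ is continuous. A function $I:[0,1]^2\to[0,1]$ satisfies (EP1) (exchange principle for $1$) if for all $x,y,z\in[0,1]$, $I(x,I(y,z))=1$ implies $I(y,I(x,z))=1$. *)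

(* Defs.v *)
From HB Require Import structures.
From mathcomp Require Import all_boot all_order all_algebra.
From mathcomp Require Import all_classical all_reals all_analysis.
Set Implicit Arguments.
Unset Strict Implicit.
Unset Printing Implicit Defensive.
Import Order.TTheory GRing.Theory Num.Theory.
Import numFieldNormedType.Exports.
Local Open Scope classical_set_scope.
Local Open Scope ring_scope.

(* Maps [0,1] -> [0,1] and [0,1]^2 -> [0,1] are encoded as functions on all of
   R; only their values on the unit interval are constrained or used. *)
Definition unit_itv (R : realType) : set R := `[0, 1]%classic.
Arguments unit_itv {R}.

Record fuzzy_negation (R : realType) (N : R -> R) : Prop := FuzzyNegation {
  fneg_unit : forall x, unit_itv x -> unit_itv (N x);
  fneg0 : N 0 = 1;
  fneg1 : N 1 = 0;
  fneg_antitone : forall x y, unit_itv x -> unit_itv y -> y <= x -> N x <= N y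
}.

Definition frontier (R : realType) (N : R -> R) : Prop :=
  forall x, unit_itv x -> (N x = 0 \/ N x = 1) <-> (x = 0 \/ x = 1).

(* Continuity is joint continuity on the square, in the subspace topology. *)
Record general_overlap (R : realType) (GO : R -> R -> R) : Prop :=
  GeneralOverlap {
  go_unit : forall x y, unit_itv x -> unit_itv y -> unit_itv (GO x y);
  go_sym : forall x y, unit_itv x -> unit_itv y -> GO x y = GO y x;
  go_mul0 : forall x y, unit_itv x -> unit_itv y -> x * y = 0 -> GO x y = 0;
  go_mul1 : forall x y, unit_itv x -> unit_itv y -> x * y = 1 -> GO x y = 1;
  go_mono_l : forall x x' y, unit_itv x -> unit_itv x' -> unit_itv y ->
    x <= x' -> GO x y <= GO x' y;
  go_mono_r : forall x y y', unit_itv x -> unit_itv y -> unit_itv y' ->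
    y <= y' -> GO x y <= GO x y';
  go_cont : {within unit_itv `*` unit_itv,
    continuous (fun p : R * R => GO p.1 p.2)}
}.

Definition EP1 (R : realType) (I : R -> R -> R) : Prop :=
  forall x y z, unit_itv x -> unit_itv y -> unit_itv z ->
    I x (I y z) = 1 -> I y (I x z) = 1.

Definition go_implication (R : realType) (GO : R -> R -> R) (N : R -> R)
  : R -> R -> R := fun x y => N (GO x (N y)).

Lemma go_implication_unit (R : realType) (GO : R -> R -> R) (N : R -> R) :
  general_overlap GO -> fuzzy_negation N ->
  forall x y, unit_itv x -> unit_itv y -> unit_itv (go_implication GO N x y).
Proof.
move=> hG hN x y hx hy.
by apply: (fneg_unit hN); apply: (go_unit hG) => //; apply: (fneg_unit hN).
Qed.

(* Main.v *)
Require Import Defs.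
From mathcomp Require Import all_boot all_order all_algebra.
From mathcomp Require Import all_classical all_reals all_analysis.
Import Order.TTheory GRing.Theory Num.Theory.
Import numFieldNormedType.Exports.
Local Open Scope classical_set_scope.
Local Open Scope ring_scope.

(** Being frontier means that [N] takes the value 1 only at 0 and the value 0
    only at 1, and the hypothesis on [GO] says that it has no zero divisors.
    Hence the implication equals 1 exactly in the two unavoidable cases: its
    antecedent is 0 or its consequent is 1 ([go_implication_eq1]).  Applying
    this twice, I(x, I(y, z)) = 1 means that x = 0 or y = 0 or z = 1, and this
    condition is symmetric in x and y, so the exchange principle holds. *)

Lemma frontier_eq1 (R : realType) (N : R -> R) :
  fuzzy_negation N -> frontier N ->
  forall x, unit_itv x -> N x = 1 <-> x = 0.
Proof.
move=> hN hfr x hx; split=> [Nx1|->]; last exact: fneg0 hN.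
have [//|x1] : x = 0 \/ x = 1 by apply/(hfr x hx); right.
by move/eqP: Nx1; rewrite x1 (fneg1 hN) eq_sym oner_eq0.
Qed.

Lemma frontier_eq0 (R : realType) (N : R -> R) :
  fuzzy_negation N -> frontier N ->
  forall x, unit_itv x -> N x = 0 <-> x = 1.
Proof.
move=> hN hfr x hx; split=> [Nx0|->]; last exact: fneg1 hN.
have [x0|//] : x = 0 \/ x = 1 by apply/(hfr x hx); left.
by move/eqP: Nx0; rewrite x0 (fneg0 hN) oner_eq0.
Qed.

(** The value 1 forces GO(x, N(y)) = 0; without zero divisors one of the two
    arguments vanishes, and N(y) = 0 forces y = 1. *)
Lemma go_implication_eq1 (R : realType) (GO : R -> R -> R) (N : R -> R) :
  general_overlap GO ->
  (forall x y : R, unit_itv x -> unit_itv y -> GO x y = 0 -> x * y = 0) ->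
  fuzzy_negation N -> frontier N ->
  forall x y, unit_itv x -> unit_itv y ->
    go_implication GO N x y = 1 <-> x = 0 \/ y = 1.
Proof.
move=> hGO hGO0 hN hfr x y hx hy.
have hNy : unit_itv (N y) by exact: fneg_unit hN _ hy.
have hG : unit_itv (GO x (N y)) by exact: go_unit hGO _ _ hx hNy.
split=> [/(frontier_eq1 _ _ hN hfr _ hG)/(hGO0 _ _ hx hNy)/eqP|xy].
  rewrite mulf_eq0 => /orP[/eqP ->|/eqP Ny0]; first by left.
  by right; apply/(frontier_eq0 _ _ hN hfr _ hy).
apply/(frontier_eq1 _ _ hN hfr _ hG)/(go_mul0 hGO hx hNy).
by case: xy => ->; rewrite ?mul0r ?(fneg1 hN) ?mulr0.
Qed.

Theorem proposition15 (R : realType) (GO : R -> R -> R) (N : R -> R)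
  (hGO : general_overlap GO)
  (hGO0 : forall x y : R, unit_itv x -> unit_itv y -> GO x y = 0 -> x * y = 0)
  (hN : fuzzy_negation N) (hfr : frontier N) :
  EP1 (go_implication GO N).
Proof.
move=> x y z hx hy hz.
have I1 := go_implication_eq1 _ _ _ hGO hGO0 hN hfr.
have IU := go_implication_unit hGO hN.
move=> /(I1 _ _ hx (IU _ _ hy hz)) h.
apply/(I1 _ _ hy (IU _ _ hx hz)).
case: h => [x0|/(I1 _ _ hy hz) [y0|z1]].
- by right; apply/(I1 _ _ hx hz); left.
- by left.
- by right; apply/(I1 _ _ hx hz); right.
Qed.
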